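(* For each integer $w \geq 2$ let $C_{1,w}$ denote the zero-error capacity (in bits per time slot) of the $(1,w)$-channel. Then the limit $\lim_{w\to\infty} C_{1,w}$ exists and $$\inf_{w \geq 2} C_{1,w} = \lim_{w \to \infty} C_{1,w} = \log_2 \phi ,$$ where $\phi = \frac{1}{2}(1+\sqrt{5})$ is the golden ratio.
   Context: **The $(1,w)$-channel.** Fix an integer $w \geq 2$, a signaling interval $T>0$, a propagation delay $\tau \in \mathbb{R}$, and a pulse $p:\mathbb{R}\to\mathbb{R}$ of duration at most $T$ (a nonzero function vanishing outside an interval of length at most $T$). All of these are known to the receiver. The transmitter sends a signal $S(t) = \sum_k a_k\, p(t-kT)$ with $a_k \in \{0,1\}$, and the receiver obtains $$R(t) = \sum_k a_k\, p(t - kT - \tau - \tau_k),$$ where each $\tau_k \in \{-\frac{T}{2}, +\frac{T}{2}\}$ is chosen randomly (arbitrarily, for zero-error purposes) and separately for each $k$, subject to: $\tau_k = +\frac{T}{2}$ whenever $k \equiv 1 \pmod w$, and $\tau_k = -\frac{T}{2}$ whenever $k \equiv 0 \pmod w$. Thus time is divided into groups of $w$ consecutive slots (slots $1,\ldots,w$, then $w+1,\ldots,2w$, and so on). In each group a pulse in the first slot is shifted right by $T/2$, a pulse in the last slot is shifted left by $T/2$, and a pulse in any other slot is shifted by $T/2$ either left or right. Pulses from different groups cannot mix, so the channel is regarded as a memoryless channel with input alphabet $\{0,1\}^w$, one channel use being one group of $w$ slots. **Confusability graph.** $\Gamma_w$ is the graph with vertex set $\{0,1\}^w$ in which two distinct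 strings $a, b$ are adjacent if and only if they are confusable. This means that there are admissible choices of shifts $(\tau_k)_{k=1}^w$ for $a$ and $(\tau'_k)_{k=1}^w$ for $b$ that produce the same output waveform, i.e. for all $t\in\mathbb{R}$, $$\sum_{k=1}^w a_k\, p(t-kT-\tau-\tau_k) = \sum_{k=1}^w b_k\, p(t-kT-\tau-\tau'_k).$$ **Zero-error capacity.** Measured in bits per time slot, $$C_{1,w} = \frac{1}{w}\lim_{n\to\infty} \frac{1}{n}\log_2 \alpha\big(\Gamma_w^{\boxtimes n}\big),$$ where $\alpha$ is the independence number and $\Gamma_w^{\boxtimes n}$ is the $n$-fold strong product (two distinct $n$-tuples of strings are adjacent if and only if, in every coordinate, the two entries are equal or adjacent in $\Gamma_w$). That is, $C_{1,w}$ is $\frac1w$ times the Shannon capacity, in bits, of $\Gamma_w$. *)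

(* Defs.v *)
From HB Require Import structures.
From mathcomp Require Import all_boot all_order all_algebra.
From mathcomp Require Import all_classical all_reals all_analysis.

Set Implicit Arguments.
Unset Strict Implicit.
Unset Printing Implicit Defensive.

Import Order.TTheory GRing.Theory Num.Theory.
Import numFieldNormedType.Exports.

Local Open Scope classical_set_scope.
Local Open Scope ring_scope.

(* A graph on a finite type V is given by its adjacency relation e : rel V. *)

Definition independent (V : finType) (e : rel V) (A : {set V}) : bool :=
  [forall x in A, forall y in A, ~~ e x y].

Definition independence_number (V : finType) (e : rel V) : nat :=
  \max_(A : {set V} | independent e A) #|A|.

Definition strong_power (V : finType) (e : rel V) (n : nat) :
    rel {ffun 'I_n -> V} :=
  fun x y => (x != y) && [forall i, (x i == y i) || e (x i) (y i)].

Definition log2 (R : realType) (x : R) : R := ln x / ln 2.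

Definition golden_ratio (R : realType) : R := (1 + Num.sqrt 5) / 2.

(* The endpoints of the supporting interval are allowed: p may be nonzero at
   both a and b even when b - a = T. *)
Definition is_pulse (R : realType) (T : R) (p : R -> R) : Prop :=
  (exists t, p t <> 0) /\
  exists a b : R, b - a <= T /\ forall t, t \notin `[a, b] -> p t = 0.

(* The slots 1, ..., w of one group are indexed by 'I_w: the index k stands for
   the slot number k.+1. *)
Definition bitstring (w : nat) : finType := {ffun 'I_w -> bool}.

Definition admissible_shifts (R : realType) (T : R) (w : nat)
    (s : 'I_w -> R) : Prop :=
  forall k : 'I_w,
    [/\ s k = - (T / 2) \/ s k = T / 2,
        (k.+1 = 1 %[mod w])%N -> s k = T / 2 &
        (k.+1 = 0 %[mod w])%N -> s k = - (T / 2)].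

Definition received (R : realType) (T tau : R) (p : R -> R) (w : nat)
    (a : bitstring w) (s : 'I_w -> R) (t : R) : R :=
  \sum_(k < w) (a k)%:R * p (t - k.+1%:R * T - tau - s k).

Definition confusable (R : realType) (T tau : R) (p : R -> R) (w : nat)
    (a b : bitstring w) : Prop :=
  exists s s' : 'I_w -> R,
    [/\ admissible_shifts T s, admissible_shifts T s' &
        forall t : R, received T tau p a s t = received T tau p b s' t].

Definition confusability_graph (R : realType) (T tau : R) (p : R -> R)
    (w : nat) : rel (bitstring w) :=
  fun a b => (a != b) && `[< confusable T tau p a b >].

(* Bits per channel use of an optimal zero-error code of block length n. *)
Definition zero_error_rate (R : realType) (T tau : R) (p : R -> R) (w n : nat)
    : R :=
  n%:R^-1 *
  log2 (independence_number
          (strong_power (confusability_graph T tau p (w := w)) (n := n)))%:R.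

(* [limn] returns a default value when there is no limit, so the existence of
   this limit has to be asserted separately. *)
Definition zero_error_capacity (R : realType) (T tau : R) (p : R -> R)
    (w : nat) : R :=
  w%:R^-1 * limn (zero_error_rate T tau p w).

(* Main.v *)
(* Two words are confusable iff they have the same weight and their i-th ones
   lie at most one slot apart, for every i.  The words in which the number of
   zeros before each one is even form an independent set.  Moving a one one slot
   to the left whenever the number of zeros before it is odd maps every word to
   such a codeword, and the fibres of this map are cliques.  Independent sets
   and clique covers are both multiplicative under strong products, so the
   capacity is log2 N_w / w where N_w, the number of codewords, satisfies the
   Fibonacci recursion and phi^w <= N_w <= phi^(w+1). *)
Require Import Defs.
From HB Require Import structures.
From mathcomp Require Import all_boot all_order all_algebra.
From mathcomp Require Import all_classical all_reals all_analysis.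
From mathcomp Require Import zify lra ring.

Set Implicit Arguments.
Unset Strict Implicit.
Unset Printing Implicit Defensive.

Import Order.TTheory GRing.Theory Num.Theory.
Import numFieldNormedType.Exports.

(** * Prefix weights, even-gap words and the settling map *)

Definition prefix_weight (s : seq bool) (j : nat) : nat := count id (take j s).

(** [odd_zeros] is the parity of the number of zeros already read; trailing zeros are
    unconstrained. *)
Fixpoint even_gaps (odd_zeros : bool) (s : seq bool) : bool :=
  match s with
  | [::] => true
  | true :: s' => ~~ odd_zeros && even_gaps odd_zeros s'
  | false :: s' => even_gaps (~~ odd_zeros) s'
  end.

(* Moves the ones that follow an odd number of zeros one slot to the left;
   [pending] tells that a zero has been read but not yet written. *)
Fixpoint settle (pending : bool) (s : seq bool) : seq bool :=
  match s, pending with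
  | [::], _ => nseq pending false
  | true :: s', _ => true :: settle pending s'
  | false :: s', false => settle true s'
  | false :: s', true => [:: false, false & settle false s']
  end.

Fixpoint codewords (n : nat) (odd_zeros : bool) : seq (seq bool) :=
  match n with
  | 0 => [:: [::]]
  | n'.+1 =>
      (if odd_zeros then [::] else map (cons true) (codewords n' false))
        ++ map (cons false) (codewords n' (~~ odd_zeros))
  end.

Lemma prefix_weightS s j :
  prefix_weight s j.+1 = prefix_weight s j + nth false s j.
Proof.
rewrite /prefix_weight; elim: s j => [|x s IH] [|j] //=.
  by rewrite take0 /= addn0.
by rewrite -addnA; congr (_ + _); exact: IH.
Qed.

Lemma prefix_weight0 s : prefix_weight s 0 = 0.
Proof. by rewrite /prefix_weight take0. Qed.

Lemma leq_prefix_weight s j : prefix_weight s j <= prefix_weight s j.+1.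
Proof. by rewrite prefix_weightS leq_addr. Qed.

Lemma prefix_weight_cons x s j :
  prefix_weight (x :: s) j.+1 = x + prefix_weight s j.
Proof. by []. Qed.

Lemma size_settle pending s : size (settle pending s) = pending + size s.
Proof. by elim: s pending => [|[] s IH] [] //=; rewrite IH. Qed.

Lemma count_settle pending s : count id (settle pending s) = count id s.
Proof. by elim: s pending => [|[] s IH] [] //=; rewrite IH. Qed.

Lemma even_gaps_settle pending s : even_gaps false (settle pending s).
Proof. by elim: s pending => [|[] s IH] [] /=. Qed.

(** Putting the pending zero back in front of the unread input gives an invariant that passes
    through the recursion of [settle]. *)
Lemma prefix_weight_settle_pending (pending : bool) s j :
  prefix_weight (nseq pending false ++ s) j
    <= prefix_weight (settle pending s) j
    <= prefix_weight (nseq pending false ++ s) j.+1.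
Proof.
elim: s pending j => [|[] s IH] [] [|j] //=;
  rewrite ?prefix_weight0 //.
- have /= := IH true j; rewrite !prefix_weight_cons.
  case: j => [|j]; first by rewrite !prefix_weight0 => /andP[_].
  by rewrite !prefix_weight_cons; have := leq_prefix_weight s j; lia.
- by have /= := IH false j; rewrite !prefix_weight_cons; lia.
- case: j => [|j]; first by rewrite !prefix_weight_cons.
  by have /= := IH false j; rewrite !prefix_weight_cons.
- exact: (IH true j.+1).
Qed.

Lemma prefix_weight_settle s j :
  prefix_weight s j <= prefix_weight (settle false s) j <= prefix_weight s j.+1.
Proof. exact: (prefix_weight_settle_pending false). Qed.

Lemma even_gaps_separated odd_zeros s t :
    size s = size t -> even_gaps odd_zeros s -> even_gaps odd_zeros t ->
    count id s = count id t ->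
    (forall j, prefix_weight s j <= prefix_weight t j.+1) ->
    (forall j, prefix_weight t j <= prefix_weight s j.+1) ->
  s = t.
Proof.
(* At the first disagreement the word with the zero enters the odd state, so it ends or continues
   with a second zero. Ending contradicts equal weights; two zeros leave no one in two slots,
   against a one in the first slot of the other word. *)
have diff s' t' : size s' = size t' -> even_gaps true t' ->
    count id (true :: s') = count id t' ->
    (forall j, prefix_weight (true :: s') j <= prefix_weight (false :: t') j.+1) ->
    False.
  case: t' => [|[] t'] //=.
  by move=> _ _ _ /(_ 1); rewrite !prefix_weight_cons !prefix_weight0.
elim: s t odd_zeros => [|x s IH] [|y t] // o [eq_sz].
case: x y => [] [] /=.
- move=> /andP[/negbTE-> ct] /andP[_ cs] [eq_w] le_st le_ts; congr (_ :: _).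
  by apply: (IH t false) => // j;
    [have := le_st j.+1 | have := le_ts j.+1];
    rewrite !prefix_weight_cons leq_add2l.
- by case: o => //= _ ct eq_w le_st _; case: (diff s t).
- by case: o => //= cs _ eq_w _ le_ts; case: (diff t s).
- move=> cs ct eq_w le_st le_ts; congr (_ :: _).
  by apply: (IH t (~~ o)) => // j;
    [have := le_st j.+1 | have := le_ts j.+1].
Qed.

(** * Counting the codewords *)

Lemma mem_codewords n odd_zeros s :
  (s \in codewords n odd_zeros) = (size s == n) && even_gaps odd_zeros s.
Proof.
have cons_inj (x : bool) : injective (cons x) by move=> ? ? [].
have notin_cons (x : bool) l r : (x :: l \in map (cons (~~ x)) r) = false.
  by apply/mapP => -[u _] []; case: x.
elim: n s odd_zeros => [|n IH] [|x s] o //=.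
  by rewrite mem_cat; apply/orP => -[]; case: o => //= /mapP[].
rewrite mem_cat eqSS; case: x o => [] [] //=.
- by rewrite andbF (notin_cons true).
- by rewrite (notin_cons true) orbF mem_map ?IH.
- by rewrite mem_map ?IH.
- by rewrite (notin_cons false) mem_map ?IH.
Qed.

Lemma uniq_codewords n odd_zeros : uniq (codewords n odd_zeros).
Proof.
have cons_inj (x : bool) : injective (cons x) by move=> ? ? [].
elim: n odd_zeros => [|n IH] [] //=; first by rewrite map_inj_uniq.
rewrite cat_uniq !map_inj_uniq // !IH /= andbT.
by apply/hasPn => _ /mapP[s _ ->]; apply/mapP => -[].
Qed.

(** Such a codeword begins with a one or with two zeros: after a single zero the parity is odd and
    forbids a one. *)
Lemma size_codewordsSS n :
  size (codewords n.+2 false)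
    = size (codewords n.+1 false) + size (codewords n false).
Proof. by rewrite [LHS]/= size_cat !size_map. Qed.

(** * Independence number of strong powers *)

(** The tuples over [I] form an independent set. Conversely, applying [c] in every coordinate is
    injective on any independent set, since tuples with the same image are equal or adjacent. *)
Lemma independence_number_strong_power (V : finType) (e : rel V)
    (I : {set V}) (c : V -> V) (n : nat) :
    independent e I -> (forall x, c x \in I) ->
    (forall x y, c x = c y -> (x == y) || e x y) ->
  independence_number (@strong_power V e n) = #|I| ^ n.
Proof.
move=> /forall_inP indepI cI c_clique.
have card_prod : #|[set x : {ffun 'I_n -> V} | x \in ffun_on I]%SET| = #|I| ^ n.
  by rewrite cardsE card_ffun_on card_ord.
apply/eqP; rewrite eqn_leq; apply/andP; split; last first.
  rewrite -card_prod; apply: bigop.leq_bigmax_cond.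
  apply/forall_inP => x; rewrite inE => /ffun_onP xI.
  apply/forall_inP => y; rewrite inE => /ffun_onP yI.
  apply/negP => /andP[/eqP neq /forallP adj]; apply: neq; apply/ffunP => i.
  have /orP[/eqP //|exy] := adj i.
  by have /forall_inP/(_ _ (yI i)) := indepI _ (xI i); rewrite exy.
apply/bigmax_leqP => A /forall_inP indepA.
pose f (x : {ffun 'I_n -> V}) := [ffun i => c (x i)].
have f_inj : {in A &, injective f}.
  move=> x y xA yA /ffunP fxy; apply/eqP/negPn/negP => neq.
  have /forall_inP/(_ _ yA)/negP := indepA _ xA; apply.
  rewrite /strong_power neq; apply/forallP => i; apply: c_clique.
  by have := fxy i; rewrite !ffunE.
rewrite -(card_in_imset f_inj) -card_prod; apply: subset_leq_card.
apply/fintype.subsetP => _ /imsetP[x _ ->].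
by rewrite inE; apply/ffun_onP => i; rewrite ffunE.
Qed.

(** * Words as functions and as sequences *)

Lemma size_codom_ord (w : nat) (a : bitstring w) : size (codom a) = w.
Proof. by rewrite size_codom card_ord. Qed.

Lemma nth_codom_ord (w : nat) (a : bitstring w) (k : 'I_w) :
  nth false (codom a) k = a k.
Proof. by rewrite codom_ffun nth_fgraph_ord. Qed.

Lemma codom_inj (w : nat) : injective (fun a : bitstring w => codom a).
Proof.
by move=> a b eq_ab; apply/ffunP => k; rewrite -!nth_codom_ord eq_ab.
Qed.

Lemma codom_nth (w : nat) (s : seq bool) : size s = w ->
  codom ([ffun k : 'I_w => nth false s k] : bitstring w) = s.
Proof.
move=> sz; apply: (@eq_from_nth _ false); first by rewrite size_codom_ord.
move=> k; rewrite size_codom_ord => kw.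
by rewrite -[k]/(nat_of_ord (Ordinal kw)) nth_codom_ord ffunE.
Qed.

Lemma prefix_weight_all (s : seq bool) (j : nat) : (size s <= j)%N ->
  prefix_weight s j = count id s.
Proof. by move=> sj; rewrite /prefix_weight take_oversize. Qed.

Definition settle_bits (w : nat) (a : bitstring w) : bitstring w :=
  [ffun k : 'I_w => nth false (settle false (codom a)) k].

Lemma codom_settle_bits (w : nat) (a : bitstring w) :
  codom (settle_bits a) = settle false (codom a).
Proof. by rewrite codom_nth // size_settle size_codom_ord. Qed.

Lemma card_even_gaps (w : nat) :
  #|[set a : bitstring w | even_gaps false (codom a)]%SET|
    = size (codewords w false).
Proof.
rewrite cardE -(size_map (fun a : bitstring w => codom a)).
apply/perm_size/uniq_perm; last 1 first.
- move=> s; rewrite mem_codewords; apply/mapP/andP => [[a]|[/eqP sz gaps]].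
    by rewrite mem_enum inE => gaps ->; rewrite size_codom_ord eqxx.
  exists [ffun k : 'I_w => nth false s k]; last by rewrite codom_nth.
  by rewrite mem_enum inE codom_nth.
- by rewrite map_inj_uniq ?enum_uniq//; exact: codom_inj.
- exact: uniq_codewords.
Qed.

Local Open Scope classical_set_scope.
Local Open Scope ring_scope.

(** * Golden ratio and Fibonacci growth *)

Lemma golden_ratio_sqr (R : realType) :
  golden_ratio R ^+ 2 = golden_ratio R + 1.
Proof.
have := @sqr_sqrtr R 5 (ler0n _ _); rewrite /golden_ratio.
by move: (Num.sqrt 5) => x; rewrite !expr2 => h; lra.
Qed.

Lemma golden_ratio_bounds (R : realType) : 1 <= golden_ratio R <= 2.
Proof.
have s0 := @sqrtr_ge0 R 5.
have := @sqr_sqrtr R 5 (ler0n _ _); rewrite /golden_ratio => h.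
have h1 : 1 <= Num.sqrt 5 :> R by rewrite expr2 in h; nra.
have h3 : Num.sqrt 5 <= 3 :> R by rewrite expr2 in h; nra.
lra.
Qed.

Lemma size_codewords_bounds (R : realType) (n : nat) :
  golden_ratio R ^+ n <= (size (codewords n false))%:R
    <= golden_ratio R ^+ n.+1.
Proof.
(* Two consecutive lengths are carried together, as the Fibonacci recursion requires. *)
suff [] : golden_ratio R ^+ n <= (size (codewords n false))%:R
    <= golden_ratio R ^+ n.+1 /\
    golden_ratio R ^+ n.+1 <= (size (codewords n.+1 false))%:R
    <= golden_ratio R ^+ n.+2 by [].
have := golden_ratio_sqr R; have := golden_ratio_bounds R.
set phi := golden_ratio R => bnd sqr.
elim: n => [|n [IH1 IH2]]; last split => //.
  by rewrite expr0 expr1 sqr /= ; lra.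
have fibphi m : phi ^+ m.+2 = phi ^+ m.+1 + phi ^+ m.
  by rewrite -addn2 exprD sqr mulrDr mulr1 -exprSr.
rewrite size_codewordsSS natrD; move: IH1 IH2 (fibphi n) (fibphi n.+1).
move: (phi ^+ n) (phi ^+ n.+1) (phi ^+ n.+2) (phi ^+ n.+3) => *; lra.
Qed.

(** * Waveforms and confusability *)

(** Lets equal waveforms be compared coefficient by coefficient. *)
Lemma pulse_translates_free (R : realType) (T delta : R) (p : R -> R)
    (n : nat) (d : nat -> R) :
    0 < T -> is_pulse T p ->
    (forall t, \sum_(k < n) d k * p (t - k%:R * T - delta) = 0) ->
  forall k, (k < n)%N -> d k = 0.
Proof.
move=> T_gt0 [[t0 pt0] [a [b [abT p0]]]].
have outside t : t < a \/ b < t -> p t = 0.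
  by move=> ht; apply: p0; rewrite in_itv /=; apply/negP; lra.
have at0 : a <= t0 by rewrite leNgt; apply/negP => h; apply/pt0/outside; left.
have t0b : t0 <= b by rewrite leNgt; apply/negP => h; apply/pt0/outside; right.
have mul0 x : x * p t0 = 0 -> x = 0.
  by move/eqP; rewrite mulf_eq0 => /orP[/eqP//|/eqP/pt0].
have mT (m : nat) : T <= m.+1%:R * T by rewrite ler_peMl ?ler1n // ltW.
(* [a, b] may contain t0 + T (if t0 = a) or t0 - T (if t0 = b), but not both:
   the coefficients vanish successively from the last or from the first one. *)
have [t0T|t0T] := ltP b (t0 + T).
- elim: n => [|n IH] free k //.
  have dn : d n = 0.
    apply: mul0; have := free (t0 + n%:R * T + delta); rewrite big_ord_recr /=.
    rewrite big1 => [|i _].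
      by rewrite add0r; congr (_ * p _ = 0); lra.
    rewrite outside ?mulr0 //; right; apply: (lt_le_trans t0T).
    have := mT (n - i.+1)%N; rewrite subnSK // natrB ?(ltnW (ltn_ord i)) //.
    by rewrite mulrBl; lra.
  rewrite ltnS leq_eqVlt => /orP[/eqP->//|]; apply: IH => t.
  by have := free t; rewrite big_ord_recr /= dn mul0r addr0.
(* Dropping the first term shifts the indices by one and the offset by [T], hence the generalisation
   over [d] and [delta]. *)
- elim: n d delta => [|n IH] d delta free k //.
  have d0 : d 0%N = 0.
    apply: mul0; have := free (t0 + delta); rewrite big_ord_recl /=.
    rewrite big1 => [|i _].
      by rewrite addr0; congr (_ * p _ = 0); lra.
    by rewrite outside ?mulr0 //; left; have := mT i; rewrite /bump /=; lra.
  case: k => [//|k]; rewrite ltnS; apply: (IH (d \o S) (delta + T)) => t.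
  have := free t; rewrite big_ord_recl /= d0 mul0r add0r => {2}<-.
  apply: eq_bigr => i _; congr (_ * p _).
  by rewrite /bump /= natrD; ring.
Qed.

(* Position k is the boundary between the slots k and k+1, numbered from 1: a
   pulse in slot k lands on position k-1 or k.  If C k pulses land on the
   positions 0, ..., k, then [increment C k] of them land on position k. *)
Definition increment (R : realType) (C : nat -> nat) (k : nat) : R :=
  (C k)%:R - (if k is k'.+1 then (C k')%:R else 0).

(** Summation by parts. The pulses on positions 0, ..., k are those of slots 1, ..., k and that of
    slot k+1 if it moves left. *)
Lemma received_increments (R : realType) (T tau : R) (p : R -> R) (w : nat)
    (a : bitstring w) (s : 'I_w -> R) (C : nat -> nat) (t : R) :
    0 < T -> admissible_shifts T s ->
    (forall k : 'I_w,
      C k = prefix_weight (codom a) k + (a k && (s k == - (T / 2))))%N ->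
    C w = count id (codom a) ->
  received T tau p a s t
    = \sum_(k < w.+1) increment R C k * p (t - k%:R * T - (T / 2 + tau)).
Proof.
move=> T_gt0 adm CE Cw.
pose A k : R := (prefix_weight (codom a) k)%:R.
pose q k := p (t - k%:R * T - (T / 2 + tau)).
have A0 : A 0%N = 0 by rewrite /A prefix_weight0.
have Aw : A w = (C w)%:R by rewrite /A Cw prefix_weight_all ?size_codom_ord.
(* Since [u] vanishes at [w], telescoping it leaves only the term of position 0. *)
pose u k := ((C k)%:R - A k) * q k.
have -> : received T tau p a s t
    = \sum_(k < w) ((A k.+1 - (C k)%:R) * q k.+1 + ((C k)%:R - A k) * q k).
  apply: eq_bigr => k _; have [shift _ _] := adm k.
  rewrite /A prefix_weightS nth_codom_ord CE !natrD.
  have half_neq : (T / 2 == - (T / 2)) = false by apply/eqP; lra.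
  case: (a k) => /=; last by ring.
  case: shift => ->; rewrite ?eqxx ?half_neq /=.
    have -> : t - k.+1%:R * T - tau - - (T / 2)
        = t - k%:R * T - (T / 2 + tau) by rewrite -natr1; lra.
    by rewrite -/(q k); ring.
  have -> : t - k.+1%:R * T - tau - T / 2
      = t - k.+1%:R * T - (T / 2 + tau) by ring.
  by rewrite -/(q k.+1); ring.
rewrite big_ord_recl.
have <- : - (\sum_(k < w) (u k.+1 - u k)) = increment R C 0 * q 0%N.
  rewrite -(big_mkord xpredT (fun k => u k.+1 - u k)) telescope_sumr //.
  by rewrite /u /increment Aw A0; ring.
rewrite -sumrN -big_split /=; apply: eq_bigr => k _.
by rewrite /u /increment /bump /= add1n /q; ring.
Qed.

(** Equal waveforms have equal landing counts [C], and for [j < w] the value [C j] lies between the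
    prefix weights at [j] and [j.+1] of either word. *)
Lemma confusable_prefix_weight (R : realType) (T tau : R) (p : R -> R) (w : nat)
    (a b : bitstring w) :
    0 < T -> is_pulse T p -> confusable T tau p a b ->
  count id (codom a) = count id (codom b) /\
  forall j, (prefix_weight (codom a) j <= prefix_weight (codom b) j.+1)%N.
Proof.
move=> T_gt0 pulse [s [s' [adm adm' eq_rec]]].
(* At [k = w] there is no slot left: [insub] fails and [C] is the total weight. *)
pose C (a : bitstring w) (s : 'I_w -> R) k :=
  (prefix_weight (codom a) k
    + oapp (fun i => a i && (s i == - (T / 2))) false (insub k))%N.
have CE a' s0 (k : 'I_w) :
  C a' s0 k = (prefix_weight (codom a') k + (a' k && (s0 k == - (T / 2))))%N.
  by rewrite /C valK.
have Cw a' s0 : C a' s0 w = count id (codom a').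
  by rewrite /C insubF ?ltnn // addn0 prefix_weight_all ?size_codom_ord.
have bounds (a' : bitstring w) s0 k : (k < w)%N ->
    (prefix_weight (codom a') k <= C a' s0 k <= prefix_weight (codom a') k.+1)%N.
  move=> kw; rewrite -[k]/(nat_of_ord (Ordinal kw)) CE prefix_weightS.
  by rewrite nth_codom_ord leq_addr leq_add2l; case: (a' _) => //; exact: leq_b1.
have incr k : (k < w.+1)%N -> increment R (C a s) k - increment R (C b s') k = 0.
  apply: (@pulse_translates_free _ T (T / 2 + tau) p w.+1
    (fun k => increment R (C a s) k - increment R (C b s') k)) => // t.
  under eq_bigr do rewrite mulrBl.
  rewrite sumrB -(received_increments tau p t T_gt0 adm (CE a s) (Cw a s)).
  rewrite -(received_increments tau p t T_gt0 adm' (CE b s') (Cw b s')).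
  by rewrite eq_rec subrr.
have eqC k : (k < w.+1)%N -> C a s k = C b s' k.
  elim: k => [|k IH] kw; apply/eqP; rewrite -(eqr_nat R) -subr_eq0;
    have := incr _ kw; rewrite /increment ?(IH (ltnW kw)).
    by rewrite !subr0 => ->.
  by move=> <-; apply/eqP; ring.
have eq_count : count id (codom a) = count id (codom b).
  by rewrite -(Cw a s) eqC // Cw.
split=> // j; have [jw|wj] := ltnP j w; last first.
  by rewrite !prefix_weight_all ?size_codom_ord ?eq_count // leqW.
have /andP[le_aC _] := bounds a s j jw; have /andP[_ le_Cb] := bounds b s' j jw.
by rewrite (leq_trans le_aC) // eqC // ltnW.
Qed.

(** The sequence [Z] serves both words as landing counts, from which their shifts are read off. *)
Lemma prefix_weight_confusable (R : realType) (T tau : R) (p : R -> R) (w : nat)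
    (a b : bitstring w) (Z : nat -> nat) :
    0 < T -> (2 <= w)%N -> Z 0%N = 0%N ->
    count id (codom a) = count id (codom b) ->
    (forall j, prefix_weight (codom a) j <= Z j <= prefix_weight (codom a) j.+1)%N ->
    (forall j, prefix_weight (codom b) j <= Z j <= prefix_weight (codom b) j.+1)%N ->
  confusable T tau p a b.
Proof.
move=> T_gt0 w_ge2 Z0 eq_count Za Zb.
(* The last slot must shift left, so all pulses have landed by position [w - 1], even if [Z] is
   smaller there. *)
pose C k := if k.+1 == w then count id (codom a) else Z k.
have shifts (c : bitstring w) : count id (codom c) = count id (codom a) ->
    (forall j, prefix_weight (codom c) j <= Z j <= prefix_weight (codom c) j.+1)%N ->
  exists2 s : 'I_w -> R, admissible_shifts T s &
    (forall t, received T tau p c s t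
       = \sum_(k < w.+1) increment R C k * p (t - k%:R * T - (T / 2 + tau))).
  move=> cE Zc.
  pose s (k : 'I_w) : R :=
    if (k.+1 == w) || (C k == (prefix_weight (codom c) k).+1) then - (T / 2)
    else T / 2.
  have half_neq : (T / 2 == - (T / 2)) = false by apply/eqP; lra.
  have adm : admissible_shifts T s.
    move=> k; rewrite /s; split; first by case: ifP; [left | right].
      (* The first slot does shift right: [w >= 2] separates it from the last slot, and [Z 0 = 0]
         puts no pulse on position 0. *)
      have := ltn_ord k; rewrite leq_eqVlt => /orP[/eqP->|kw].
        by rewrite modnn modn_small.
      rewrite !modn_small // => -[k0]; rewrite /C k0 prefix_weight0 Z0.
      by rewrite ltn_eqF.
    have := ltn_ord k; rewrite leq_eqVlt => /orP[->//|kw].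
    by rewrite modn_small // mod0n.
  exists s => // t; apply: received_increments => //; last first.
    have := Zc w; rewrite !prefix_weight_all ?size_codom_ord // -eqn_leq.
    by move=> /eqP ->; rewrite /C gtn_eqF.
  move=> k; rewrite /s /C; case: eqP => [kw|_] /=.
    rewrite eqxx andbT -cE -(@prefix_weight_all _ k.+1); last first.
      by rewrite size_codom_ord kw.
    by rewrite prefix_weightS nth_codom_ord.
  have := Zc k; rewrite prefix_weightS nth_codom_ord.
  by case: (Z k =P _) => [->|]; rewrite ?eqxx ?half_neq; case: (c k) => /=; lia.
have [s adm rec_s] := shifts a erefl Za.
have [s' adm' rec_s'] := shifts b (esym eq_count) Zb.
by exists s, s'; split=> // t; rewrite rec_s rec_s'.
Qed.

(** * Capacity and its limit *)

(** Words with the same settled form are confusable, the prefix weights of that form serving as [Z];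
    [even_gaps_separated] gives independence. *)
Lemma independence_number_confusability (R : realType) (T tau : R) (p : R -> R)
    (w n : nat) :
    0 < T -> is_pulse T p -> (2 <= w)%N ->
  independence_number
      (strong_power (confusability_graph T tau p (w := w)) (n := n))
    = (size (codewords w false) ^ n)%N.
Proof.
move=> T_gt0 pulse w_ge2; rewrite -card_even_gaps.
apply: (@independence_number_strong_power _ _ _ (@settle_bits w)).
- apply/forall_inP => a; rewrite inE => gaps_a.
  apply/forall_inP => b; rewrite inE => gaps_b.
  apply/negP => /andP[/eqP neq /asboolP conf]; apply: neq; apply: codom_inj.
  have conf' : confusable T tau p b a.
    by case: conf => s [s' [? ? eq_rec]]; exists s', s; split.
  have [eq_count le_ab] := confusable_prefix_weight T_gt0 pulse conf.
  have [_ le_ba] := confusable_prefix_weight T_gt0 pulse conf'.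
  by apply: (@even_gaps_separated false) => //; rewrite !size_codom_ord.
- by move=> a; rewrite inE codom_settle_bits even_gaps_settle.
- move=> a b eq_settle; rewrite /confusability_graph.
  have [//|neq /=] := eqVneq a b; apply/asboolP.
  have {}eq_settle : settle false (codom a) = settle false (codom b).
    by rewrite -!codom_settle_bits eq_settle.
  apply: (@prefix_weight_confusable _ _ _ _ _ _ _
    (prefix_weight (settle false (codom a)))) => //.
  + exact: prefix_weight0.
  + by rewrite -(count_settle false) eq_settle count_settle.
  + exact: prefix_weight_settle.
  + by rewrite eq_settle; exact: prefix_weight_settle.
Qed.

(** The equality is only eventual because the rate at [n = 0] is 0, the inverse of 0 being 0. *)
Lemma zero_error_rate_near (R : realType) (T tau : R) (p : R -> R) (w : nat) :
    0 < T -> is_pulse T p -> (2 <= w)%N ->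
  \forall n \near \oo,
    zero_error_rate T tau p w n = log2 (size (codewords w false))%:R.
Proof.
move=> T_gt0 pulse w_ge2; near=> n.
have n_gt0 : (0 < n)%N by near: n; exact: nbhs_infty_gt.
rewrite /zero_error_rate independence_number_confusability // natrX /log2.
have [low _] := andP (size_codewords_bounds R w).
have N_gt0 : 0 < (size (codewords w false))%:R :> R.
  apply: lt_le_trans low; apply: exprn_gt0.
  by have := golden_ratio_bounds R; lra.
rewrite lnXn // -[ln _ *+ n]mulr_natl -mulrA mulKf // pnatr_eq0 -lt0n //.
Unshelve. all: by end_near.
Qed.

Lemma zero_error_capacity_bounds (R : realType) (T tau : R) (p : R -> R)
    (w : nat) :
    0 < T -> is_pulse T p -> (2 <= w)%N ->
  log2 (golden_ratio R) <= zero_error_capacity T tau p w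
    <= log2 (golden_ratio R) + w%:R^-1 * log2 (golden_ratio R).
Proof.
move=> T_gt0 pulse w_ge2.
have phi_gt0 : 0 < golden_ratio R by have := golden_ratio_bounds R; lra.
have w_gt0 : 0 < w%:R :> R by rewrite ltr0n ltnW.
have ln2_gt0 : 0 < ln 2 :> R by rewrite ln_gt0 // ltr1n.
have /andP[low high] := size_codewords_bounds R w.
rewrite /zero_error_capacity.
have near_log := zero_error_rate_near tau T_gt0 pulse w_ge2.
rewrite (lim_near_cst (@norm_hausdorff _ _) near_log) //.
have N_gt0 : 0 < (size (codewords w false))%:R :> R.
  by apply: lt_le_trans low; exact: exprn_gt0.
have log2_le x y : 0 < x -> 0 < y -> x <= y -> log2 x <= log2 y :> R.
  by move=> ? ? ?; rewrite ler_pM2r ?invr_gt0 // ler_ln.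
have log2X m : log2 (golden_ratio R ^+ m) = m%:R * log2 (golden_ratio R).
  by rewrite /log2 lnXn // -[ln _ *+ m]mulr_natl mulrA.
rewrite ler_pdivlMl // -[X in X + _](mulKf (lt0r_neq0 w_gt0)) -mulrDr.
rewrite ler_pM2l ?invr_gt0 // -log2X log2_le ?exprn_gt0 //=.
rewrite log2X -[X in _ <= _ + X]mul1r -mulrDl natr1 -log2X.
by rewrite log2_le ?exprn_gt0.
Qed.

Theorem corollary2 (R : realType) (T tau : R) (p : R -> R)
    (T_gt0 : 0 < T) (p_pulse : is_pulse T p) :
  [/\ forall w : nat, (2 <= w)%N -> cvgn (zero_error_rate T tau p w),
      inf [set zero_error_capacity T tau p w | w in [set w : nat | (2 <= w)%N]]
        = log2 (golden_ratio R) &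
      zero_error_capacity T tau p w @[w --> \oo] --> log2 (golden_ratio R)].
Proof.
have bounds w : (2 <= w)%N -> _ :=
  zero_error_capacity_bounds tau T_gt0 p_pulse.
have lim_capacity :
    zero_error_capacity T tau p w @[w --> \oo] --> log2 (golden_ratio R).
  have upper : log2 (golden_ratio R) + w%:R^-1 * log2 (golden_ratio R)
      @[w --> \oo] --> log2 (golden_ratio R).
    rewrite -[X in _ --> X]addr0; apply: cvgD; first exact: cvg_cst.
    rewrite -[X in _ --> X](mul0r (log2 (golden_ratio R))).
    (* The harmonic sequence is 1/(n+1), hence the shift by one. *)
    by apply: cvgMr_tmp; rewrite -cvg_shiftS; exact: cvg_harmonic.
  apply: (squeeze_cvgr _ (cvg_cst _) upper); near=> w.
  by apply: bounds; near: w; exact: nbhs_infty_ge.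
have lb : lbound [set zero_error_capacity T tau p w | w in [set w | (2 <= w)%N]]
    (log2 (golden_ratio R)).
  by move=> _ [w w_ge2 <-]; have /andP[] := bounds w w_ge2.
split=> // [w w_ge2|].
  exact: (is_cvg_near_cst _ (zero_error_rate_near tau T_gt0 p_pulse w_ge2)).
apply/eqP; rewrite eq_le; apply/andP; split; last first.
  by apply: lb_le_inf => //; exists (zero_error_capacity T tau p 2), 2%N.
(* The infimum lies below every capacity with [w >= 2], hence below their limit. *)
apply: (cvgr_to_ge lim_capacity); near=> w.
apply: ge_inf; first by exists (log2 (golden_ratio R)).
by exists w => //=; near: w; exact: nbhs_infty_ge.
Unshelve. all: by end_near.
Qed.
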